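(* There exists a finite tree $T$ with exactly $32$ leaves, all of whose vertices have degree one or three, such that for every assignment $w$ of positive real lengths to the edges of $T$, the least integer $m$ for which the metric realization $|T|_w$ embeds isometrically into $(\mathbb{R}^m,\|\cdot\|_\infty)$ is equal to $6$.
   Context: A leaf of a finite tree is a vertex of degree one. Given a finite tree $T$ with positive edge lengths $w$, its metric realization $|T|_w$ is the geodesic metric space obtained by replacing each edge $e$ by a closed interval of length $w(e)$, glued at the endpoints according to the incidences of $T$, with the induced path-length metric. $\|\cdot\|_\infty$ denotes the maximum norm on $\mathbb{R}^m$. An isometric embedding is a distance-preserving map (not necessarily surjective). *)

(* Defs.v *)
From HB Require Import structures.
From Stdlib Require Import Relation_Operators.
From mathcomp Require Import all_boot all_order all_algebra.
From mathcomp Require Import generic_quotient.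
From mathcomp Require Import boolp classical_sets reals.
From mathcomp Require Import topology normedtype.

Set Implicit Arguments.
Unset Strict Implicit.
Unset Printing Implicit Defensive.

Import Order.TTheory GRing.Theory Num.Theory.
Import numFieldNormedType.Exports.

Local Open Scope ring_scope.
Local Open Scope quotient_scope.

(* [ucycle e c]: c lists, without repetition, the vertices of a closed e-walk;
   such a c with at least three vertices is exactly a cycle of the graph. *)
Definition is_tree (V : finType) (e : rel V) : Prop :=
  [/\ (exists v : V, True),
      symmetric e,
      irreflexive e,
      (forall x y : V, connect e x y) &
      (forall c : seq V, ucycle e c -> (size c <= 2)%N)].

Definition degree (V : finType) (e : rel V) (v : V) : nat :=
  #|[set u : V | e v u]|.

Definition leaves (V : finType) (e : rel V) : {set V} :=
  [set v : V | degree e v == 1]%N.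

(* An undirected edge {x, y} is represented once, by the pair whose first
   component comes first in the enumeration of V; this fixes the
   parametrization of the interval that replaces the edge. *)
Definition edge (V : finType) (e : rel V) : Type :=
  {p : V * V | e p.1 p.2 && (enum_rank p.1 < enum_rank p.2)%N}.
Definition src (V : finType) (e : rel V) (a : edge e) : V := (val a).1.
Definition tgt (V : finType) (e : rel V) (a : edge e) : V := (val a).2.
HB.instance Definition _ (V : finType) (e : rel V) := Finite.on (edge e).

Section MetricRealization.
Context {R : realType} {V : finType} {e : rel V} (w : edge e -> R).

Definition edge_interval (a : edge e) : Type := {t : R | 0 <= t <= w a}.
HB.instance Definition _ (a : edge e) := Choice.on (edge_interval a).

(* The disjoint union of the vertices and of the intervals [0, w a]. *)
Definition pieces : Type := (V + {a : edge e & edge_interval a})%type.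
HB.instance Definition _ := Choice.on pieces.

Definition piece_point (a : edge e) (t : edge_interval a) : pieces :=
  inr (existT (fun b => edge_interval b) a t).

Inductive attach : pieces -> pieces -> Prop :=
| attach_src (a : edge e) (t : edge_interval a) :
    val t = 0 -> attach (piece_point t) (inl (src a))
| attach_tgt (a : edge e) (t : edge_interval a) :
    val t = w a -> attach (piece_point t) (inl (tgt a)).

Definition glue (p q : pieces) : bool :=
  `[< clos_refl_sym_trans pieces attach p q >].

Lemma glue_refl : reflexive glue.
Proof. by move=> p; apply/asboolP; apply: rst_refl. Qed.

Lemma glue_sym : symmetric glue.
Proof. by move=> p q; apply/asboolP/asboolP; apply: rst_sym. Qed.

Lemma glue_trans : transitive glue.
Proof.
move=> q p r /asboolP pq /asboolP qr; apply/asboolP.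
exact: rst_trans pq qr.
Qed.

Canonical glue_equiv := EquivRel glue glue_refl glue_sym glue_trans.

Definition realization : Type := {eq_quot glue_equiv}.

Definition edge_point (a : edge e) (t : edge_interval a) : realization :=
  \pi_{eq_quot glue_equiv} (piece_point t).

(* [path_length x y l]: some piecewise linear path from x to y, made of
   finitely many segments each lying in a single closed edge, has length l. *)
Inductive path_length : realization -> realization -> R -> Prop :=
| path_length_refl x : path_length x x 0
| path_length_step (a : edge e) (s t : edge_interval a) (y : realization) (l : R) :
    path_length (edge_point t) y l ->
    path_length (edge_point s) y (`|val s - val t| + l).

(* The set below is bounded below by 0, and nonempty when the graph is
   connected and w is nonnegative. *)
Definition path_dist (x y : realization) : R := inf [set l | path_length x y l]%classic.

(* The norm of ['rV[R]_m] is [mx_norm], the maximum of the absolute values of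
   the coordinates (0 when m = 0). *)
Definition embeds_linf (m : nat) : Prop :=
  exists f : realization -> 'rV[R]_m,
    forall x y : realization, `|f x - f y| = path_dist x y.

Definition least_linf_dim (m : nat) : Prop :=
  embeds_linf m /\ (forall k : nat, embeds_linf k -> (m <= k)%N).

End MetricRealization.

(* Main.v *)
Require Import Defs.
From Stdlib Require Import Relation_Operators NArith.
From mathcomp Require Import all_boot all_order all_algebra.
From mathcomp Require Import generic_quotient.
From mathcomp Require Import boolp classical_sets reals.
From mathcomp Require Import topology normedtype.
From mathcomp Require Import zify ring lra.

Set Implicit Arguments.
Unset Strict Implicit.
Unset Printing Implicit Defensive.

Import Order.TTheory GRing.Theory Num.Theory.
Import numFieldNormedType.Exports.

(** In a tree, a map f to R^m is isometric for the maximum norm exactly when every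
    coordinate is 1-Lipschitz and every pair of points has its distance
    attained by some coordinate. A coordinate that attains the distance of two
    vertices u and v has slope +1 (or -1) along the whole path from u to v,
    so the slopes of one coordinate orient the edges, and the path is directed
    in that orientation. Conversely an orientation integrates to a function of
    slope 1 along the oriented edges. Hence |T|_w embeds in dimension m if and
    only if T has m orientations such that each path between distinct vertices
    is directed in at least one of them ([embeds_of_orientations],
    [orientations_of_embeds]), a condition in which w does not occur.

    Write 1 for a single leaf and [a, b] for the rooted tree with branches a and
    b. Let c2 = [1, 1], c4 = [c2, c2], c8 = [c4, c4], c5 = [1, c4] and
    c13 = [c5, c8]. The tree T is made of two adjacent vertices, one with the
    further branches c13 and c4, the other with the further branches c13 and c2.

    Six orientations suffice because T, rooted at the middle of the edge that
    joins these two vertices, is a binary tree of height six: in the i-th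
    orientation the first branch of each fork of depth i points up and the
    second one points down, so that a path whose top is a fork of depth i is
    directed ([level_orientation_directed]).

    Suppose that five orientations suffice. Each leaf x gets the vector in
    {0,1}^5 of the orientations of its edge. Two leaves get different vectors,
    as an orientation in which the path between them is directed leaves one of
    them and enters the other; so the 32 leaves are in bijection with the points
    of the cube. An edge z cuts the leaves into two parts, and if x and y lie on
    different sides, then some orientation i agrees on x and z and disagrees on
    y ([edge_separates]). When the points of x and y are adjacent in the cube,
    i is the coordinate in which they differ, so the part A of the cube on one
    side of z is unate: for each i, all steps in direction i that leave A go the
    same way ([leaf_codes_unate]).

    It remains to see that the cube has no decomposition into unate sets that
    follows the shape of T. The unate sets of two points are the edges of the
    cube, those that split into two edges are the squares, those that split into
    two squares are the three-dimensional faces, and those that split as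
    prescribed by c13 are the half-cubes minus a path of three points. This leaves
    so few candidates that an enumeration ([not_completable]) excludes them all. *)

(** * Trees given by a parent function *)

Section ParentTree.
Local Open Scope nat_scope.

Variable p : nat -> nat.

(** The chain of v cut off after k vertices. *)
Fixpoint chain_rec (k v : nat) : seq nat :=
  if k is k'.+1 then if v is 0 then [::] else v :: chain_rec k' (p v) else [::].

(** The vertices other than the root 0 on the path from v to the root, v first. A
    vertex z > 0 also stands for the edge between z and its parent [p z], so the
    chain lists the edges of that path as well. *)
Definition chain (v : nat) : seq nat := chain_rec v v.

(** The edge above z lies between v and the root; that is, z is a nonroot vertex,
    and is v or an ancestor of v. *)
Definition anc (z v : nat) : bool := z \in chain v.

(** The edge above z separates u from v, that is, lies on the path between them. *)
Definition sep (z u v : nat) : bool := anc z u (+) anc z v.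

(** The tree with vertices 0, ..., n in which each v > 0 is joined to [p v]. *)
Definition parent_rel (n : nat) : rel 'I_n.+1 := fun u v =>
  (0 < v) && (u == p v :> nat) || (0 < u) && (v == p u :> nat).

(** An orientation of the edges is a map s from nonroot vertices to bool, where
    [s z] means that the edge above z points away from the root. On the path from
    u to v the edges above the ancestors of u are travelled upwards and the
    other ones downwards; [b] tells whether the path is directed from u to v. *)
Definition directed (n : nat) (s : nat -> bool) (u v : nat) : Prop :=
  exists b, forall z, 0 < z <= n -> sep z u v -> s z (+) anc z u = b.

Hypothesis p_lt : forall v, 0 < v -> p v < v.

Lemma chain_recE k v : v <= k -> chain_rec k v = chain v.
Proof.
rewrite /chain; elim/ltn_ind: v k => -[|v] IH [|k] //= le_vk.
have := p_lt (ltn0Sn v) => lt_pv.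
by rewrite !IH //; lia.
Qed.

Lemma chainS v : 0 < v -> chain v = v :: chain (p v).
Proof.
case: v => // v _; rewrite {1}/chain /= chain_recE //.
by have := p_lt (ltn0Sn v).
Qed.

Lemma chain_gt0 z v : z \in chain v -> 0 < z <= v.
Proof.
elim/ltn_ind: v => -[|v] IH; first by rewrite in_nil.
rewrite chainS // inE => /orP[/eqP-> //|]; first by rewrite leqnn.
have := p_lt (ltn0Sn v) => lt_pv /(IH _ lt_pv); lia.
Qed.

Lemma anc_gt z v : v < z -> anc z v = false.
Proof. by move=> lt_vz; apply/negP => /chain_gt0; lia. Qed.

Lemma ancS z v : 0 < v -> anc z v = (z == v) || anc z (p v).
Proof. by move=> v_gt0; rewrite /anc chainS // inE. Qed.

Lemma anc_refl v : 0 < v -> anc v v.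
Proof. by move=> v_gt0; rewrite ancS // eqxx. Qed.

Lemma anc_parent z : 0 < z -> anc z (p z) = false.
Proof. by move=> z_gt0; rewrite anc_gt // p_lt. Qed.

Lemma sepC z u v : sep z u v = sep z v u.
Proof. exact: addbC. Qed.

(** For u < v the path from u to v ends with the edge above v, as v is not an
    ancestor of u. *)
Lemma sep_parent z u v : 0 < v -> u < v -> sep z u v = (z == v) (+) sep z u (p v).
Proof.
move=> v_gt0 lt_uv; rewrite /sep (ancS z v_gt0); case: (eqVneq z v) => [->|_] //=.
by rewrite anc_parent // anc_gt.
Qed.

Lemma sep_exists u v : u != v -> exists z, [/\ 0 < z, z <= maxn u v & sep z u v].
Proof.
wlog lt_uv : u v / u < v => [W|_].
  rewrite neq_ltn => /orP[lt_uv|lt_vu]; first by apply: W; rewrite ?neq_ltn ?lt_uv.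
  have [z [z1 z2 z3]] : exists z, [/\ 0 < z, z <= maxn v u & sep z v u].
    by apply: W; rewrite ?neq_ltn ?lt_vu.
  by exists z; rewrite maxnC sepC.
have v_gt0 : 0 < v by lia.
by exists v; split; rewrite ?leq_maxr // /sep anc_gt // anc_refl.
Qed.

Variable n : nat.
Let V : finType := 'I_n.+1.
Let e : rel V := parent_rel (n := n).

Lemma parent_rel_sym : symmetric e.
Proof. by move=> u v; rewrite /e /parent_rel orbC. Qed.

Lemma parent_rel_irr : irreflexive e.
Proof.
move=> v; rewrite /e /parent_rel orbb; case: (posnP v) => //= v_gt0.
by rewrite gtn_eqF // p_lt.
Qed.

Lemma parent_rel_le u v : e u v -> u <= v -> 0 < v /\ u = p v :> nat.
Proof.
rewrite /e /parent_rel => /orP[/andP[? /eqP ->]|/andP[u_gt0 /eqP->]] //.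
by have := p_lt u_gt0; lia.
Qed.

Lemma parent_tree : is_tree e.
Proof.
split; [by exists ord0 | exact: parent_rel_sym | exact: parent_rel_irr | |].
  suff c0 (x : V) : connect e x ord0.
    move=> x y; apply: connect_trans (c0 x) _.
    by rewrite (sym_connect_sym parent_rel_sym).
  have [k le_xk] := ubnP (nat_of_ord x); elim: k x le_xk => // k IH x le_xk.
  case: (posnP x) => [x0|x_gt0].
    by rewrite (_ : x = ord0) ?connect0 //; apply: val_inj.
  have lt_px : p x < n.+1 by apply: ltn_trans (p_lt x_gt0) _.
  apply: connect_trans (IH (Ordinal lt_px) _); last by apply: leq_trans (p_lt x_gt0) _.
  by apply: connect1; rewrite /e /parent_rel /= eqxx x_gt0 orbT.
move=> c /andP[cyc_c uniq_c]; rewrite leqNgt; apply/negP => lt_c.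
(* On a cycle, both neighbours of the largest vertex are its parent. *)
have [x xc x_max] : exists2 x, x \in c & forall y, y \in c -> y <= x.
  case: c lt_c {cyc_c uniq_c} => // x0 c _.
  have [x xc xm] := @arg_maxnP _ x0 (mem (x0 :: c)) (@nat_of_ord _) (mem_head _ _).
  by exists x.
case: (rot_to xc) => i s rs.
have: cycle e (x :: s) by rewrite -rs rot_cycle.
have: uniq (x :: s) by rewrite -rs rot_uniq.
have ms y : y \in x :: s -> y <= x by rewrite -rs mem_rot; apply: x_max.
have: 2 < size (x :: s) by rewrite -rs size_rot.
case: s ms {rs} => // y [//|y' s] ms _ uniq_s /=.
rewrite rcons_path => /and3P[exy _ /andP[_ ezx]].
have zs : last y' s \in y' :: s by apply: mem_last.
rewrite parent_rel_sym in exy.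
have [_ yE] : 0 < x /\ y = p x :> nat.
  by apply: parent_rel_le exy _; apply: ms; rewrite !inE eqxx orbT.
have [_ zE] : 0 < x /\ last y' s = p x :> nat.
  by apply: parent_rel_le ezx _; apply: ms; rewrite 2!in_cons zs !orbT.
move: uniq_s => /and3P[_ /negP]; case; rewrite (_ : y = last y' s) //.
by apply: val_inj; rewrite /= yE.
Qed.

End ParentTree.

(** * Paths in the metric realization *)

Section Metric.
Local Open Scope ring_scope.
Local Open Scope quotient_scope.

Section Realization.

Variables (R : realType) (V : finType) (e : rel V) (w : edge e -> R).
Hypothesis w_gt0 : forall a, 0 < w a.

Definition vertex_point (v : V) : realization w :=
  \pi_(realization w) (inl v : pieces w).

Lemma edge_start_subproof (a : edge e) : (0 : R) <= 0 <= w a.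
Proof. by rewrite lexx ltW. Qed.

Lemma edge_end_subproof (a : edge e) : 0 <= w a <= w a.
Proof. by rewrite lexx andbT ltW. Qed.

(** The two ends of the interval that realizes an edge. *)
Definition edge_start (a : edge e) : edge_interval w a :=
  exist _ 0 (edge_start_subproof a).
Definition edge_end (a : edge e) : edge_interval w a :=
  exist _ (w a) (edge_end_subproof a).

Lemma edge_point_start a : edge_point (edge_start a) = vertex_point (src a).
Proof.
by apply/eqmodP/asboolP/rst_step; apply: attach_src.
Qed.

Lemma edge_point_end a : edge_point (edge_end a) = vertex_point (tgt a).
Proof.
by apply/eqmodP/asboolP/rst_step; apply: attach_tgt.
Qed.

Lemma path_length_trans x y z l l' :
  path_length (w := w) x y l -> path_length y z l' -> path_length x z (l + l').
Proof.
move=> xy; elim: xy l' => [t|a s t y' l1 _ IH] l' yz; first by rewrite add0r.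
by rewrite -addrA; apply/path_length_step/IH.
Qed.

Lemma path_length_edge a (s t : edge_interval w a) :
  path_length (edge_point s) (edge_point t) `|val s - val t|.
Proof.
rewrite -[X in path_length _ _ X]addr0.
exact/path_length_step/path_length_refl.
Qed.

Lemma path_length_sym x y l : path_length (w := w) x y l -> path_length y x l.
Proof.
elim=> [t|a s t y' l1 _ IH]; first exact: path_length_refl.
rewrite addrC distrC; apply: path_length_trans IH _.
exact: path_length_edge.
Qed.

Lemma path_length_ge0 x y l : path_length (w := w) x y l -> 0 <= l.
Proof. by elim=> // a s t y' l1 _ l1_ge0; rewrite addr_ge0. Qed.

Lemma path_dist_le x y l : path_length (w := w) x y l -> path_dist x y <= l.
Proof.
move=> xy; apply: ge_inf => //; exists 0 => l' /=; exact: path_length_ge0.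
Qed.

Lemma le_path_dist x y l r : path_length (w := w) x y l ->
  (forall l', path_length x y l' -> r <= l') -> r <= path_dist x y.
Proof. by move=> xy r_le; apply: lb_le_inf; [exists l | move=> l' /r_le]. Qed.

End Realization.

(** * Isometric embeddings and orientations *)

Section Embedding.

Variables (p : nat -> nat) (n : nat).
Hypothesis p_lt : forall v, (0 < v)%N -> (p v < v)%N.
Let e : rel 'I_n.+1 := parent_rel p (n := n).

(** The enumeration of ordinals is increasing, so the target of an edge is the
    end that is farther from the root. *)
Lemma edge_parent (a : edge e) : (0 < tgt a)%N /\ src a = p (tgt a) :> nat.
Proof.
have /andP[eab] := valP a; rewrite !enum_rank_ord /= => lt_ab.
exact: (parent_rel_le p_lt eab (ltnW lt_ab)).
Qed.

Lemma src_lt_tgt (a : edge e) : (src a < tgt a)%N.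
Proof. by have [/p_lt lt_p ->] := edge_parent a. Qed.

Lemma edge_inj (a b : edge e) : tgt a = tgt b -> a = b.
Proof.
move=> ab; have [_ a1] := edge_parent a; have [_ b1] := edge_parent b.
apply: val_inj; rewrite [val a]surjective_pairing [val b]surjective_pairing.
congr (_, _) => //; apply: val_inj.
by rewrite -[LHS]/(nat_of_ord (src a)) a1 ab -b1.
Qed.

Lemma tgt_eqE (a b : edge e) : (tgt a == tgt b :> nat) = (a == b).
Proof. by apply/eqP/eqP => [/val_inj/edge_inj|->]. Qed.

Lemma edge_exists (v : 'I_n.+1) : (0 < v)%N -> exists a : edge e, tgt a = v.
Proof.
move=> v_gt0; have lt_pn : (p v < n.+1)%N by apply: ltn_trans (p_lt v_gt0) _.
have Pe : e (Ordinal lt_pn) v && (enum_rank (Ordinal lt_pn) < enum_rank v)%N.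
  by rewrite !enum_rank_ord /= p_lt // /e /parent_rel v_gt0 eqxx.
by exists (exist _ (Ordinal lt_pn, v) Pe).
Qed.

Variables (R : realType) (w : edge e -> R).
Hypothesis w_gt0 : forall a, 0 < w a.

Local Notation anc := (anc p).
Local Notation sep := (sep p).

(** The length of the path from u to v: the total weight of the edges that
    separate them. *)
Definition tree_dist (u v : nat) : R :=
  \sum_(a : edge e) (sep (tgt a) u v)%:R * w a.

Lemma tree_distC u v : tree_dist u v = tree_dist v u.
Proof. by apply: eq_bigr => a _; rewrite sepC. Qed.

Lemma tree_distxx u : tree_dist u u = 0.
Proof. by apply: big1 => a _; rewrite /sep addbb mul0r. Qed.

Lemma tree_dist_edges (A : {set edge e}) (u v u' v' : nat) :
  (forall a : edge e, sep (tgt a) u v = (a \in A) (+) sep (tgt a) u' v') ->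
  (forall a : edge e, a \in A -> sep (tgt a) u' v' = false) ->
  tree_dist u v = \sum_(a in A) w a + tree_dist u' v'.
Proof.
move=> sepE sepA; rewrite [X in X + _]big_mkcond -big_split /=.
apply: eq_bigr => a _; rewrite sepE; case: ifP => aA; last by rewrite add0r.
by rewrite sepA //= mul1r mul0r addr0.
Qed.

Lemma tree_dist_parent u (a : edge e) : (u < tgt a)%N ->
  tree_dist u (tgt a) = w a + tree_dist u (src a).
Proof.
move=> lt_ua; have [a_gt0 aE] := edge_parent a.
rewrite (@tree_dist_edges [set a] _ _ u (src a)) ?big_set1 // => b; rewrite inE.
  by rewrite sep_parent // -aE tgt_eqE.
by move=> /eqP->; rewrite aE /sep (anc_gt p_lt lt_ua) anc_parent.
Qed.

Lemma tree_path (u v : 'I_n.+1) :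
  path_length (vertex_point w u) (vertex_point w v) (tree_dist u v).
Proof.
have [k] := ubnP (u + v); elim: k => // k IH in u v *.
wlog lt_uv : u v / (u < v)%N => [W|] lt_k.
  have [lt_uv|lt_vu|/val_inj->] := ltngtP u v; first exact: W.
    by rewrite tree_distC; apply: path_length_sym; apply: W; rewrite // addnC.
  by rewrite tree_distxx; apply: path_length_refl.
have [a av] : exists a : edge e, tgt a = v by apply: edge_exists; lia.
have lt_av : (src a < v)%N by rewrite -av src_lt_tgt.
rewrite -av tree_dist_parent ?av // addrC -av.
apply: path_length_trans (IH u (src a) _) _; first by lia.
rewrite -(edge_point_start w_gt0) -(edge_point_end w_gt0).
have := path_length_edge (edge_start w_gt0 a) (edge_end w_gt0 a).
by rewrite /= sub0r normrN gtr0_norm.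
Qed.

(** The sum of h over the edges between the root and v. *)
Definition rise (h : edge e -> R) (v : nat) : R :=
  \sum_(a : edge e) (anc (tgt a) v)%:R * h a.

Lemma rise_tgt h (a : edge e) : rise h (tgt a) = rise h (src a) + h a.
Proof.
have [a_gt0 aE] := edge_parent a.
rewrite /rise (bigD1 a) //= [in RHS](bigD1 a) //= anc_refl // mul1r.
rewrite aE anc_parent // mul0r add0r addrC; congr (_ + _).
apply: eq_bigr => b ba; rewrite (ancS p_lt _ a_gt0).
by rewrite tgt_eqE (negPf ba).
Qed.

(** A function on the vertices is recovered from its increments along the edges. *)
Lemma rise_diff (g : 'I_n.+1 -> R) (v : 'I_n.+1) :
  rise (fun a : edge e => g (tgt a) - g (src a)) v = g v - g ord0.
Proof.
have [k] := ubnP (nat_of_ord v); elim: k => // k IH in v *.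
case: (posnP v) => [v0 _|v_gt0 lt_vk].
  have -> : v = ord0 by apply: val_inj.
  by rewrite subrr; apply: big1 => a _; rewrite /anc /= mul0r.
have [a av] := edge_exists v_gt0; rewrite -av rise_tgt IH; last first.
  by apply: leq_trans (src_lt_tgt a) _; rewrite av.
by ring.
Qed.

(** The function on the vertices with value 0 at the root whose slope, away
    from the root, on the edge above z is -1 if [s z] holds and 1 otherwise;
    [piece_height] and [point_height] extend it to the realization. *)
Definition height (s : nat -> bool) : nat -> R :=
  rise (fun a => (-1) ^+ s (tgt a) * w a).

Lemma tree_dist_gt0 (u v : 'I_n.+1) : u != v -> 0 < tree_dist u v.
Proof.
move=> /(sep_exists p_lt)[z [z_gt0 z_le sep_z]].
have lt_zn : (z < n.+1)%N.
  by rewrite ltnS (leq_trans z_le) // geq_max -ltnS ltn_ord -ltnS ltn_ord.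
have [a aE] := @edge_exists (Ordinal lt_zn) z_gt0.
rewrite /tree_dist (bigD1 a) //= aE /= sep_z mul1r ltr_pwDl //.
by apply: sumr_ge0 => b _; rewrite mulr_ge0 // ltW.
Qed.

Lemma height_directed s u v : directed p n s u v ->
  `|height s u - height s v| = tree_dist u v.
Proof.
move=> [b dir_b]; have tree_dist_ge0 : 0 <= tree_dist u v.
  by apply: sumr_ge0 => a _; rewrite mulr_ge0 // ltW.
suff -> : height s u - height s v = - (-1) ^+ b * tree_dist u v.
  by rewrite normrM normrN normrX normrN1 expr1n mul1r ger0_norm.
rewrite -sumrB mulr_sumr; apply: eq_bigr => a _.
have [a_gt0 _] := edge_parent a; have a_le := ltn_ord (tgt a).
have a_in : (0 < tgt a <= n)%N by rewrite a_gt0 -ltnS.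
have := dir_b _ a_in; rewrite /sep.
case: (anc _ u) (anc _ v) => -[] /=; rewrite ?subrr ?mul0r ?mulr0 //.
  by move=> /(_ isT) <-; rewrite addbT; case: (s _); rewrite /=; ring.
by move=> /(_ isT) <-; rewrite addbF; case: (s _); rewrite /=; ring.
Qed.

Definition piece_height (s : nat -> bool) (q : pieces w) : R :=
  match q with
  | inl v => height s v
  | inr (existT a t) => height s (src a) + (-1) ^+ s (tgt a) * val t
  end.

Definition point_height (s : nat -> bool) (x : realization w) : R :=
  piece_height s (repr x).

Lemma point_height_pi s q : point_height s (\pi_(realization w) q) = piece_height s q.
Proof.
rewrite /point_height; case: piP => q' /eqmodP/asboolP.
elim=> [_ _ [a t t0|a t tw]|//|q1 q2 _ ->//|q1 q2 q3 _ -> _ ->//] /=.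
  by rewrite t0 mulr0 addr0.
by rewrite tw /height rise_tgt.
Qed.

Lemma point_height_vertex s v : point_height s (vertex_point w v) = height s v.
Proof. exact: point_height_pi. Qed.

Lemma point_height_edge s (a : edge e) (t : edge_interval w a) :
  point_height s (edge_point t) = height s (src a) + (-1) ^+ s (tgt a) * val t.
Proof. exact: point_height_pi. Qed.

Lemma point_height_same_edge s (a : edge e) (t t' : edge_interval w a) :
  `|point_height s (edge_point t) - point_height s (edge_point t')| =
  `|val t - val t'|.
Proof.
rewrite !point_height_edge (_ : _ - _ = (-1) ^+ s (tgt a) * (val t - val t')).
  by rewrite normrM normrX normrN1 expr1n mul1r.
by ring.
Qed.

Lemma point_height_lip s x y l : path_length x y l ->
  `|point_height s x - point_height s y| <= l.
Proof.
elim=> [z|a t t' z l1 _ IH]; first by rewrite subrr normr0.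
apply: le_trans (ler_distD (point_height s (edge_point t')) _ _) _.
by rewrite lerD // point_height_same_edge.
Qed.

Lemma path_dist_vertex (u v : 'I_n.+1) :
  path_dist (vertex_point w u) (vertex_point w v) = tree_dist u v.
Proof.
apply/eqP; rewrite eq_le (path_dist_le (tree_path u v)) /=.
(* The path between u and v is directed, from v to u, when the edges between u
   and the root point away from the root and all other ones towards it. *)
apply: le_path_dist (tree_path u v) _ => l /(point_height_lip (fun z => anc z u)).
rewrite !point_height_vertex height_directed //.
by exists false => z _ _; rewrite addbb.
Qed.

(** If the i-th coordinate g attains the distance of u and v, then the increments
    of g along the edges of the path between them, none of which exceeds the
    weight of its edge, add up to the total weight of the path up to sign. So each
    increment has the maximal size and the common sign, and the orientation of
    the edges by the sign of the increment directs the path. *)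
Lemma orientations_of_embeds m : embeds_linf w m ->
  exists s : 'I_m -> nat -> bool,
    forall u v : 'I_n.+1, u != v -> exists i, directed p n (s i) u v.
Proof.
move=> [f f_iso]; pose g i (v : 'I_n.+1) : R := f (vertex_point w v) ord0 i.
have lip i u v : `|g i u - g i v| <= tree_dist u v.
  rewrite -path_dist_vertex -f_iso [X in _ <= X]mx_normrE.
  apply: (@bigmax_sup _ _ _ _ (ord0, i)) => //.
  by rewrite !mxE.
exists (fun i z => g i (inord (p z)) < g i (inord z)) => u v uv.
have duv : `|f (vertex_point w u) - f (vertex_point w v)| = tree_dist u v.
  by rewrite f_iso path_dist_vertex.
have mx_uv : mx_norm (f (vertex_point w u) - f (vertex_point w v)) = tree_dist u v.
  by rewrite -duv.
have [i gi] : exists i, `|g i u - g i v| = tree_dist u v.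
  have /mx_norm_neq0[[k i]] : mx_norm (f (vertex_point w u) - f (vertex_point w v)) != 0.
    by rewrite mx_uv gt_eqF // tree_dist_gt0.
  by rewrite mx_uv !mxE => ->; exists i; rewrite /g /= (ord1 k).
exists i, (g i u < g i v) => z /andP[z_gt0 z_le] sep_z.
pose c (a : edge e) : R := (anc (tgt a) u)%:R - (anc (tgt a) v)%:R.
pose h (a : edge e) : R := g i (tgt a) - g i (src a).
have h_le a : `|h a| <= w a.
  apply: le_trans (lip _ _ _) _; rewrite tree_distC tree_dist_parent ?src_lt_tgt //.
  by rewrite tree_distxx addr0.
pose eps : R := (-1) ^+ (g i u < g i v)%R.
have term_ge0 (a : edge e) : 0 <= (sep (tgt a) u v)%:R * w a - eps * c a * h a.
  have := h_le a; rewrite ler_norml => /andP[h1 h2].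
  rewrite /sep /c /eps; case: (anc _ u) (anc _ v) (_ < _) => -[] [] /=; lra.
have sum0 : \sum_(a : edge e) ((sep (tgt a) u v)%:R * w a - eps * c a * h a) = 0.
  rewrite sumrB -[X in X - _]/(tree_dist u v).
  have -> : \sum_(a : edge e) eps * c a * h a = eps * (g i u - g i v).
    have -> : g i u - g i v = rise h u - rise h v by rewrite !rise_diff; ring.
    by rewrite -sumrB mulr_sumr; apply: eq_bigr => a _; rewrite /c; ring.
  rewrite -gi /eps; case: ltP => guv /=.
    by rewrite ltr0_norm ?subr_lt0 //; ring.
  by rewrite ger0_norm ?subr_ge0 //; ring.
have lt_zn : (z < n.+1)%N by [].
have [a az] := @edge_exists (Ordinal lt_zn) z_gt0.
have [_ paz] := edge_parent a.
have term0 : (sep (tgt a) u v)%:R * w a - eps * c a * h a = 0.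
  exact: (psumr_eq0P (fun b _ => term_ge0 b) sum0).
move: term0.
have -> : inord z = tgt a by apply: val_inj; rewrite az /= inordK.
have -> : inord (p z) = src a.
  by apply: val_inj; rewrite /= paz az /= inordK // (ltn_trans (p_lt z_gt0)).
move: sep_z; rewrite /c /eps /h az /= /sep.
have := w_gt0 a; case: (anc z u) (anc z v) (g i u < g i v) => -[] [] //= wa _;
  case: ltP => //=; lra.
Qed.

Hypothesis n_gt0 : (0 < n)%N.

(** This needs an edge: the one-vertex tree has a point on no edge. *)
Lemma realization_edge_point (x : realization w) :
  exists (a : edge e) (t : edge_interval w a), x = edge_point t.
Proof.
rewrite -[x]reprK; case: (repr x) => [v|[a t]]; last by exists a, t.
case: (posnP v) => [v0|v_gt0].
  have [a aE] : exists a : edge e, tgt a = inord 1 by apply: edge_exists; rewrite inordK.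
  exists a, (edge_start w_gt0 a); rewrite edge_point_start.
  suff -> : v = src a by [].
  by apply: val_inj; have := src_lt_tgt a; rewrite aE inordK //= v0; case: (src a) => -[].
have [a av] := edge_exists v_gt0; exists a, (edge_end w_gt0 a).
by rewrite edge_point_end av.
Qed.

(** The end of an edge that is its lower vertex if c holds, and its upper vertex
    otherwise. *)
Definition edge_side (a : edge e) (c : bool) : 'I_n.+1 := if c then tgt a else src a.

Definition edge_side_point (a : edge e) (c : bool) : edge_interval w a :=
  if c then edge_end w_gt0 a else edge_start w_gt0 a.

Lemma edge_side_pointE a c :
  edge_point (edge_side_point a c) = vertex_point w (edge_side a c).
Proof. by case: c; rewrite /= ?edge_point_end ?edge_point_start. Qed.

Lemma edge_side_dist a c (t : edge_interval w a) :
  `|val (edge_side_point a c) - val t| + `|val t - val (edge_side_point a (~~ c))| = w a.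
Proof.
have /andP[t_ge0 t_le] := valP t.
case: c => /=; rewrite ?subr0 ?sub0r ?normrN (ger0_norm t_ge0).
  by rewrite ger0_norm ?subr_ge0 // subrK.
by rewrite distrC ger0_norm ?subr_ge0 // subrKC.
Qed.

Lemma anc_edge_side z (a : edge e) c :
  anc z (edge_side a c) = (z == tgt a) (+) anc z (edge_side a (~~ c)).
Proof.
have [a_gt0 aE] := edge_parent a.
have E : anc z (tgt a) = (z == tgt a) (+) anc z (src a).
  by rewrite (ancS p_lt) // aE; case: eqVneq => [->|//]; rewrite anc_parent.
by case: c; rewrite /= E // addbA addbb.
Qed.

Lemma anc_edge_side_self (a : edge e) c : anc (tgt a) (edge_side a c) = c.
Proof.
have [a_gt0 aE] := edge_parent a.
by case: c; rewrite /= ?anc_refl // aE anc_parent.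
Qed.

Lemma anc_edge_side_other (z : nat) (a : edge e) c :
  z != tgt a -> anc z (edge_side a c) = anc z (tgt a).
Proof.
have [a_gt0 aE] := edge_parent a.
by case: c => // /negPf za; rewrite (ancS p_lt z a_gt0) za /= aE.
Qed.

(** Two points x and y of the realization lie on the path between two vertices,
    namely the outer ends of the edges that carry x and y; if an orientation
    directs this path, then its height function attains the distance of x and y. *)
Lemma point_pair_on_geodesic (x y : realization w) :
  exists (u v : 'I_n.+1) (l : R), [/\ u != v, path_length x y l &
    forall s, directed p n s u v -> `|point_height s x - point_height s y| = l].
Proof.
have [a [s ->]] := realization_edge_point x; have [b [t ->]] := realization_edge_point y.
have [ab|ab] := eqVneq a b.
  case: b / ab t => t; exists (src a), (tgt a), `|val s - val t|.
  split; first by rewrite -val_eqE /= ltn_eqF // src_lt_tgt.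
    exact: path_length_edge.
  by move=> o _; apply: point_height_same_edge.
have tab : tgt a != tgt b :> nat by rewrite tgt_eqE.
(* u' and v' are the ends of the two edges that face each other. *)
pose c := anc (tgt a) (tgt b); pose d := anc (tgt b) (tgt a).
pose u' := edge_side a c; pose v' := edge_side b d.
pose u := edge_side a (~~ c); pose v := edge_side b (~~ d).
have anc_a : anc (tgt a) u' = anc (tgt a) v'.
  by rewrite anc_edge_side_self anc_edge_side_other.
have anc_b : anc (tgt b) u' = anc (tgt b) v'.
  by rewrite anc_edge_side_self anc_edge_side_other // eq_sym.
have duv : tree_dist u v = w a + w b + tree_dist u' v'.
  rewrite (@tree_dist_edges [set a; b] _ _ u' v').
  - by rewrite big_setU1 ?inE //= big_set1.
  - move=> f; rewrite /sep /u /v anc_edge_side (anc_edge_side _ b) !negbK !inE.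
    rewrite !tgt_eqE addbACA; congr (_ (+) _).
    by case: (eqVneq f a) => [->|//]; rewrite (negPf ab).
  - by move=> f; rewrite !inE => /orP[]/eqP->; rewrite /sep ?anc_a ?anc_b addbb.
pose l := `|val s - val (edge_side_point a c)| + (tree_dist u' v' +
          `|val (edge_side_point b d) - val t|).
have xy : path_length (edge_point s) (edge_point t) l.
  apply: path_length_trans (path_length_edge s (edge_side_point a c)) _.
  apply: path_length_trans _ (path_length_edge (edge_side_point b d) t).
  by rewrite !edge_side_pointE; apply: tree_path.
exists u, v, l; split=> //.
  apply/eqP => uv; have := tree_distxx u; rewrite {2}uv duv.
  have : 0 <= tree_dist u' v' := path_length_ge0 (tree_path u' v').
  by have := w_gt0 a; have := w_gt0 b; lra.
move=> o /height_directed; rewrite duv -!point_height_vertex -!edge_side_pointE.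
have lip_xy := point_height_lip o xy.
have := point_height_lip o (path_length_edge (edge_side_point a (~~ c)) s).
have := point_height_lip o (path_length_edge t (edge_side_point b (~~ d))).
have := edge_side_dist (~~ c) s; have := edge_side_dist d t.
rewrite negbK => dt ds lip_t lip_s uv.
apply/eqP; rewrite eq_le lip_xy /=.
have := ler_distD (point_height o (edge_point s))
  (point_height o (edge_point (edge_side_point a (~~ c))))
  (point_height o (edge_point (edge_side_point b (~~ d)))).
have := ler_distD (point_height o (edge_point t))
  (point_height o (edge_point s))
  (point_height o (edge_point (edge_side_point b (~~ d)))).
rewrite uv /l; lra.
Qed.

Lemma embeds_of_orientations m (s : 'I_m -> nat -> bool) :
  (forall u v : 'I_n.+1, u != v -> exists i, directed p n (s i) u v) ->
  embeds_linf w m.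
Proof.
move=> dir; exists (fun x => \row_i point_height (s i) x) => x y.
have [u [v [l [uv xy lE]]]] := point_pair_on_geodesic x y.
have [i /lE li] := dir u v uv.
have -> : path_dist x y = l.
  apply/eqP; rewrite eq_le path_dist_le //=.
  by apply: le_path_dist xy _ => l' /(point_height_lip (s i)); rewrite li.
apply/eqP; rewrite eq_le [`| _ |]mx_normrE; apply/andP; split.
  apply: bigmax_le => [|[j k] _]; first exact: path_length_ge0 xy.
  by rewrite !mxE; apply: point_height_lip.
apply: (@bigmax_sup _ _ _ _ (ord0, i)) => //.
by rewrite !mxE li.
Qed.

End Embedding.

End Metric.

(** * The tree *)

Section Tree.
Local Open Scope nat_scope.

(** Rooted binary trees, without labels. *)
Inductive shape := Tip | Fork of shape & shape.

(** The number of vertices. *)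
Fixpoint shape_size (t : shape) : nat :=
  if t is Fork l r then (shape_size l + shape_size r).+1 else 1.

(** The parents of the vertices of t in preorder, when its root has number k and is
    attached to the vertex q. *)
Fixpoint shape_parents (t : shape) (q k : nat) : seq nat :=
  q :: if t is Fork l r then
         shape_parents l k k.+1 ++ shape_parents r k (k.+1 + shape_size l)
       else [::].

Definition shape2 := Fork Tip Tip.
Definition shape4 := Fork shape2 shape2.
Definition shape8 := Fork shape4 shape4.
Definition shape5 := Fork Tip shape4.
Definition shape13 := Fork shape5 shape8.

(** The tree of the theorem, rooted at vertex 0, one of the two adjacent vertices;
    the other one is vertex 29. The branches of 0 start at the vertices 1, 26 and 29,
    those of 29 at 30 and 55. Since vertices are numbered in preorder, the branches of
    a vertex z start at z + 1 and at z + 1 plus the size of the first one. *)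
Definition parent_table : seq nat := Eval compute in
  0 :: shape_parents shape13 0 1 ++ shape_parents shape2 0 26 ++
       shape_parents (Fork shape13 shape4) 0 29.

Definition par (v : nat) : nat := nth 0 parent_table v.

Definition leaf_list : seq nat := Eval compute in
  [seq v <- iota 0 62 | v \notin parent_table].

(** The leaves cut off from the root by the edge above z, in increasing order. *)
Definition below (z : nat) : seq nat := [seq x <- leaf_list | anc par z x].

Lemma par_lt v : 0 < v -> par v < v.
Proof.
case: (ltnP v 62) => [lt_v62 v_gt0|le_62v _]; last first.
  by rewrite /par nth_default //; apply: leq_trans le_62v.
have /allP/(_ v) : all (fun v => par v < v) (iota 1 61) by vm_compute.
by apply; rewrite mem_iota v_gt0.
Qed.

(** The number of neighbours of v, as a count over natural numbers. *)
Definition par_nbrs (v : nat) : nat :=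
  count (fun u => (0 < u) && (v == par u) || (0 < v) && (u == par v)) (iota 0 62).

Lemma degree_par (v : 'I_62) : degree (parent_rel par (n := 61)) v = par_nbrs v.
Proof.
rewrite /degree cardsE cardE size_filter -enumT /par_nbrs -val_enum_ord count_map.
by refine (@eq_count 'I_62 _ _ _ _) => u.
Qed.

Lemma degrees_par v : v < 62 ->
  par_nbrs v = if v \in leaf_list then 1 else 3.
Proof.
move=> lt_v; apply/eqP.
have /allP/(_ v) : all (fun v => par_nbrs v == if v \in leaf_list then 1 else 3) (iota 0 62).
  by vm_compute.
by apply; rewrite mem_iota.
Qed.

Lemma card_leaves_par : #|leaves (parent_rel par (n := 61))| = 32.
Proof.
rewrite /leaves cardsE cardE size_filter.
transitivity (count (mem leaf_list) (map val (enum 'I_62))); last first.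
  by rewrite val_enum_ord; vm_compute.
rewrite -enumT [RHS]count_map; refine (@eq_count 'I_62 _ _ _ _) => v.
rewrite -[LHS]/(degree _ v == 1) degree_par degrees_par //.
by rewrite -[RHS]/(val v \in leaf_list); case: (val v \in _).
Qed.

(** The position of z in the binary tree rooted at the middle of the edge between
    0 and 29, where 0 is in the first branch and 29 in the second one; x is in
    the second branch of its parent when its number does not follow that of
    the parent. *)
Definition address (z : nat) : bitseq :=
  let turns := rev [seq x != (par x).+1 | x <- chain par z] in
  if 29 \in chain par z then turns else false :: turns.

Definition address_table : seq bitseq := Eval compute in map address (iota 0 62).

(** Orientation i: edges in the second branch of a fork of depth i point away from
    the root, edges in the first branch point towards it. *)
Definition level_orientation (i z : nat) : bool :=
  nth false (nth [::] address_table z) i.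

(** With i the first position at which s and t differ, or the length of the
    shorter one if it is a prefix of the other, the prefixes of s that are not
    prefixes of t have the same i-th bit, and those of t that are not prefixes of
    s have the opposite one. *)
Lemma prefix_split (s t : bitseq) : s != t ->
  exists i b, [/\ i < maxn (size s) (size t),
    (forall r, prefix r s -> ~~ prefix r t -> nth false r i = b) &
    (forall r, prefix r t -> ~~ prefix r s -> nth false r i = ~~ b)].
Proof.
elim: s t => [|c s IH] [|d t] //=.
- exists 0, (~~ d); split=> // [[|? ?]//|[|d' r]//=].
  by rewrite negbK => /andP[/eqP].
- exists 0, c; split=> // [[|c' r]//=|[|? ?]//].
  by move=> /andP[/eqP].
rewrite eqseq_cons; have [<- /= /IH[i [b [lt_i ps pt]]]|cd _] := eqVneq c d.
  exists i.+1, b; split; first by rewrite maxnSS ltnS.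
    by move=> [|c' r] //= /andP[-> /ps]; apply.
  by move=> [|c' r] //= /andP[-> /pt]; apply.
exists 0, c; split=> [|[|c' r]//= /andP[/eqP]//|[|c' r]//= /andP[/eqP-> _] _].
  by rewrite maxnSS.
by case: c d cd => -[].
Qed.

(** Ancestors are the vertices whose address is a prefix. *)
Lemma address_prefix z u : 0 < z < 62 -> u < 62 ->
  anc par z u = prefix (nth [::] address_table z) (nth [::] address_table u).
Proof.
move=> lt_z lt_u; apply/eqP.
have /allP/(_ u) : all (fun u => let c := chain par u in
  let a := nth [::] address_table u in
  all (fun z => (z \in c) == prefix (nth [::] address_table z) a) (iota 1 61)) (iota 0 62).
  by vm_compute.
by rewrite mem_iota => /(_ lt_u)/allP/(_ z); rewrite mem_iota; apply.
Qed.

Lemma level_orientation_directed (u v : 'I_62) : u != v ->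
  exists i : 'I_6, directed par 61 (level_orientation i) u v.
Proof.
move=> uv; pose a x := nth [::] address_table x.
have auv : a u != a v by rewrite nth_uniq //; exact: ltn_ord.
have size_a x : size (a x) <= 6.
  have /all_nthP sizes : all (fun s : bitseq => size s <= 6) address_table by vm_compute.
  by case: (ltnP x 62) => lt_x; [apply: sizes | rewrite /a nth_default].
have [i [b [lt_i bu bv]]] := prefix_split auv.
have lt_i6 : i < 6 by rewrite (leq_trans lt_i) // geq_max !size_a.
exists (Ordinal lt_i6), (~~ b) => z lt_z.
rewrite /sep !address_prefix ?ltn_ord // /level_orientation /=.
case zu : (prefix _ _); case zv : (prefix _ _) => //= _.
  by rewrite addbT bu // zv.
by rewrite addbF bv // zu.
Qed.

(** * Lower bound: five orientations do not suffice *)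

Local Open Scope N_scope.

(** The points of the cube {0,1}^5, coded by their binary expansion. A set of
    points is the number whose k-th bit tells whether it contains k. *)
Definition points : seq N := Eval compute in map N.of_nat (iota 0 32).

(* Each entry holds i, 2 ^ i, and the set of points whose i-th bit is 1. *)
Definition axes : seq (nat * N * N) :=
  [:: (0%N, 1, 0xAAAAAAAA); (1%N, 2, 0xCCCCCCCC); (2%N, 4, 0xF0F0F0F0);
      (3%N, 8, 0xFF00FF00); (4%N, 16, 0xFFFF0000)].

(** Inclusion of sets of points. *)
Definition subN (A B : N) : bool := N.ldiff A B == 0.

(** [A1] collects the k with i-th bit 0 whose neighbour k + 2 ^ i is in A, and
    [A0] the points of A with i-th bit 0; the steps in direction i that leave A
    all go the same way exactly when one of them contains the other. *)
Definition unate (A : N) : bool :=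
  all (fun x => let A1 := N.shiftr (N.land A x.2) x.1.2 in
                let A0 := N.ldiff A x.2 in subN A1 A0 || subN A0 A1) axes.

(** The unate unions of two disjoint sets, taken from X and from Y. *)
Definition join (X Y : seq N) : seq N :=
  undup [seq N.lor ab.1 ab.2 | ab <- [seq (a, b) | a <- X, b <- Y] &
           (N.land ab.1 ab.2 == 0) && unate (N.lor ab.1 ab.2)].

(** The set with the elements of l. *)
Definition set_of (l : seq N) : N := foldr N.lor 0 [seq N.shiftl 1 k | k <- l].

Definition singletons : seq N := [seq set_of [:: k] | k <- points].

(** The sets that can be occupied by the leaves of a balanced branch with 2, 4 or 8
    leaves, and by the 17 leaves of the branch at 29 when the leaf 32 is at the
    point 0. *)
Definition cand2 : seq N := Eval vm_compute in join singletons singletons.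
Definition cand4 : seq N := Eval vm_compute in join cand2 cand2.
Definition cand8 : seq N := Eval vm_compute in join cand4 cand4.
Definition cand17 : seq N := Eval vm_compute in
  join (join (join [:: 1] cand4) cand8) cand4.

(** The complement of A splits into unate sets as the branches at 26 and 1 do: a
    pair of adjacent points e and a set W, where W contains a three-dimensional
    face o and the rest S of W contains a square q. *)
(* Nested conditionals rather than conjunctions: under call-by-value a
   conjunction evaluates both its sides. *)
Definition completable (A : N) : bool :=
  let B := N.ldiff (set_of points) A in
  has (fun e => if subN e B then let W := N.ldiff B e in
    if unate W then
      has (fun o => if subN o W then let S := N.ldiff W o in
        if unate S then has (fun q => subN q S) cand4 else false else false) cand8
    else false else false) cand2.

(** The enumeration behind the lower bound: it rules out each of the 180 sets
    that the branch at 29 can occupy. *)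
Lemma not_completable : ~~ has completable cand17.
Proof. by vm_compute. Qed.

Lemma cand2E : cand2 = join singletons singletons. Proof. by vm_compute. Qed.
Lemma cand4E : cand4 = join cand2 cand2. Proof. by vm_compute. Qed.
Lemma cand8E : cand8 = join cand4 cand4. Proof. by vm_compute. Qed.
Lemma cand17E : cand17 = join (join (join [:: 1] cand4) cand8) cand4.
Proof. by vm_compute. Qed.

Lemma N_neq0_testbit A : A <> 0 -> exists k, N.testbit A k.
Proof. by move=> /N.bit_log2 A_log; exists (N.log2 A). Qed.

Lemma subNP A B : reflect (forall k, N.testbit A k -> N.testbit B k) (subN A B).
Proof.
apply: (iffP eqP) => [AB k Ak|AB].
  by have := N.ldiff_spec A B k; rewrite AB N.bits_0 Ak /=; case: (N.testbit B k).
apply: N.bits_inj_0 => k; rewrite N.ldiff_spec.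
by case Ak : (N.testbit A k); rewrite //= AB.
Qed.

Lemma subN_witness A B : ~~ subN A B -> exists k, N.testbit A k /\ N.testbit B k = false.
Proof.
move=> /eqP/N_neq0_testbit[k]; rewrite N.ldiff_spec => /andP[Ak /negbTE Bk].
by exists k.
Qed.

Lemma axis_lower i h M k : (i, h, M) \in axes -> k \in points -> N.testbit M k ->
  k - h \in points /\ N.testbit M (k - h) = false.
Proof.
move=> axis kP Mk; have /allP/(_ _ axis)/allP/(_ k kP) : all (fun x => all (fun k =>
    N.testbit x.2 k ==> (k - x.1.2 \in points) && ~~ N.testbit x.2 (k - x.1.2))
    points) axes by vm_compute.
by rewrite /= Mk => /andP[-> /negbTE].
Qed.

Lemma axis_upper i h M k : (i, h, M) \in axes -> k \in points -> ~~ N.testbit M k ->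
  [/\ k + h \in points, N.testbit M (k + h), (i < 5)%N,
      N.testbit k (N.of_nat i) = false &
      forall j, (j < 5)%N -> N.testbit k (N.of_nat j) = ~~ N.testbit (k + h) (N.of_nat j) ->
      j = i].
Proof.
move=> axis kP Mk; have /allP/(_ _ axis)/allP/(_ k kP) : all (fun x => all (fun k =>
    ~~ N.testbit x.2 k ==> [&& k + x.1.2 \in points, N.testbit x.2 (k + x.1.2),
      (x.1.1 < 5)%N, ~~ N.testbit k (N.of_nat x.1.1) &
      all (fun j => (N.testbit k (N.of_nat j) == ~~ N.testbit (k + x.1.2) (N.of_nat j))
        ==> (j == x.1.1)) (iota 0 5)])
    points) axes by vm_compute.
rewrite /= Mk => /and5P[-> -> -> /negbTE-> /and5P[u0 u1 u2 u3 /andP[u4 _]]].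
split=> // j lt_j5 /eqP kj; apply/eqP; move: kj; apply/implyP.
by case: j lt_j5 => [|[|[|[|[|]]]]].
Qed.

Lemma mem_below x z : (x \in below z) = anc par z x && (x \in leaf_list).
Proof. exact: mem_filter. Qed.

Lemma uniq_below z : uniq (below z).
Proof. exact: filter_uniq. Qed.

(* Conversion must not try to identify two such lists by computing them. *)
#[local] Opaque below.

Lemma testbit_set_of l k : N.testbit (set_of l) k = (k \in l).
Proof.
elim: l => [|a l IH]; first exact: N.bits_0.
rewrite in_cons -IH -[set_of _]/(N.lor (N.shiftl 1 a) (set_of l)) N.lor_spec.
congr (_ || _); rewrite N.shiftl_1_l N.pow2_bits_eqb eq_sym.
exact/N.eqb_spec/eqP.
Qed.

Section LowerBound.

Variable s : nat -> nat -> bool.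
Hypothesis s_directed : forall u v : 'I_62, u != v ->
  exists2 i, (i < 5)%N & directed par 61 (s i) u v.
(* This loses no generality: reversing one orientation altogether keeps the same
   paths directed. *)
Hypothesis s_leaf32 : forall i, (i < 5)%N -> s i 32 = false.

(** The point of the cube given by the orientations of the edge above x. *)
Definition code (x : nat) : N :=
  N.b2n (s 0 x) + 2 * (N.b2n (s 1 x) + 2 * (N.b2n (s 2 x) + 2 *
    (N.b2n (s 3 x) + 2 * N.b2n (s 4 x)))).

(** The points of the leaves in l, and those of the leaves below z. *)
Definition codes (l : seq nat) : N := set_of (map code l).
Definition leaf_codes (z : nat) : N := codes (below z).

Lemma code_points x : code x \in points.
Proof. by rewrite /code; do 5 case: (s _ x). Qed.

Lemma testbit_code x i : (i < 5)%N -> N.testbit (code x) (N.of_nat i) = s i x.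
Proof.
rewrite /code; case: i => [|[|[|[|[|//]]]]] _;
  by case: (s 0 x); case: (s 1 x); case: (s 2 x); case: (s 3 x); case: (s 4 x).
Qed.

Lemma leaf_lt x : x \in leaf_list -> (0 < x < 62)%N.
Proof.
have /allP : all (fun x => 0 < x < 62)%N leaf_list by vm_compute.
by apply.
Qed.

Lemma anc_leaf x y : x \in leaf_list -> y \in leaf_list -> anc par x y = (x == y).
Proof.
move=> xl yl; have /allP/(_ y yl)/allP/(_ x xl)/eqP : all (fun y => all (fun x =>
  anc par x y == (x == y)) leaf_list) leaf_list by vm_compute.
by [].
Qed.

(** The path between the leaves x and y goes up along the edges above x and above
    z, and comes down along the edge above y; an orientation that directs it
    agrees on the first two and differs on the third one. *)
Lemma edge_separates x y z : x \in below z -> y \in leaf_list -> y \notin below z ->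
  exists2 i, (i < 5)%N & s i x = s i z /\ s i y = ~~ s i z.
Proof.
rewrite !mem_below => /andP[zx xl] yl; rewrite yl andbT => zy.
have xy : x != y by apply: contraNneq zy => <-.
have /andP[x_gt0 x_lt] := leaf_lt xl; have /andP[y_gt0 y_lt] := leaf_lt yl.
have /andP[z_gt0 z_lex] := chain_gt0 par_lt zx.
have uv : Ordinal x_lt != Ordinal y_lt by [].
have [i lt_i5 [b dir]] := s_directed uv; exists i => //.
have := dir x; have := dir y; have := dir z.
rewrite /sep /= zx (negbTE zy) !anc_leaf // !eqxx (negbTE xy) eq_sym (negbTE xy) /=.
have z_lt : (z < 62)%N by exact: leq_ltn_trans z_lex x_lt.
rewrite x_gt0 y_gt0 z_gt0 -![(_ <= 61)%N]ltnS x_lt y_lt z_lt /=.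
move=> /(_ isT isT) <- /(_ isT isT); rewrite addbF => -> /(_ isT isT).
by rewrite !addbT => /negb_inj ->.
Qed.

Lemma code_inj : {in leaf_list &, injective code}.
Proof.
move=> x y xl yl xy; apply/eqP/negPn/negP => x_neq_y.
have xx : x \in below x.
  by have /andP[x_gt0 _] := leaf_lt xl; rewrite mem_below xl (anc_refl par_lt).
have yx : y \notin below x by rewrite mem_below anc_leaf // negb_and x_neq_y.
have [i lt_i5 [_]] := edge_separates xx yl yx.
by rewrite -!testbit_code // xy; case: (N.testbit _ _).
Qed.

Lemma code_surj k : k \in points -> exists2 x, x \in leaf_list & code x = k.
Proof.
move=> kP; suff /mapP[x xl ->] : k \in map code leaf_list by exists x.
have [_ ->//] : (size (map code leaf_list) = size points) * (map code leaf_list =i points).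
apply: uniq_min_size => //.
  by rewrite map_inj_in_uniq //; apply: code_inj.
by move=> _ /mapP[x _ ->]; apply: code_points.
Qed.

Lemma testbit_leaf_codesP z k :
  reflect (exists2 x, x \in below z & code x = k) (N.testbit (leaf_codes z) k).
Proof.
rewrite testbit_set_of.
by apply: (iffP mapP) => -[x xz xk]; exists x.
Qed.

Lemma codes_ldiff l l' : {subset l <= leaf_list} -> {subset l' <= leaf_list} ->
  N.ldiff (codes l) (codes l') = codes [seq x <- l | x \notin l'].
Proof.
move=> l_sub l'_sub; apply: N.bits_inj => k.
rewrite N.ldiff_spec !testbit_set_of; apply/andP/mapP => [[/mapP[x xl ->] xl']|[x]].
  by exists x; rewrite // mem_filter xl andbT; apply: contra xl'; apply: map_f.
rewrite mem_filter => /andP[xl' xl ->]; split; first exact: map_f.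
apply/mapP => -[y yl' /code_inj xy].
by rewrite (xy (l_sub x xl) (l'_sub y yl')) yl' in xl'.
Qed.

Lemma codes_points : set_of points = codes leaf_list.
Proof.
apply: N.bits_inj => k; rewrite !testbit_set_of; apply/idP/mapP => [/code_surj|].
  by case=> x xl <-; exists x.
by case=> x _ ->; apply: code_points.
Qed.

Lemma leaf_codes_unate z : unate (leaf_codes z).
Proof.
apply/allP => -[[i h] M] axis /=; set A := leaf_codes z.
case up : (subN _ _) => //; apply/negP => /negP/subN_witness[k []].
move/negP/negP/subN_witness: up => [k1 []].
rewrite !N.ldiff_spec !N.shiftr_spec' !N.land_spec.
move=> /andP[Ak1h Mk1h] Ak1 /andP[Ak Mk] AMkh.
have step x y : x \in below z -> y \in leaf_list -> N.testbit A (code y) = false ->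
    (forall j, (j < 5)%N -> N.testbit (code x) (N.of_nat j) =
      ~~ N.testbit (code y) (N.of_nat j) -> j = i) ->
    s i x = s i z /\ s i y = ~~ s i z.
  move=> xz yl Ay diff; have yz : y \notin below z.
    by apply: contraFN Ay => yz; apply/testbit_leaf_codesP; exists y.
  have [j lt_j5 [xj yj]] := edge_separates xz yl yz.
  by rewrite -(diff j lt_j5) // !testbit_code // xj yj negbK.
(* A step from A to its complement that lowers bit i forces s i z to hold. *)
have [x xz xk1] := testbit_leaf_codesP _ _ Ak1h.
have [] := axis_lower axis _ Mk1h; first by rewrite -xk1 code_points.
rewrite N.add_sub => k1P Mk1; move: Ak1; rewrite Mk1 andbT => Ak1.
have [_ _ lt_i5 k1i k1_diff] := axis_upper axis k1P (negbT Mk1).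
have [y yl yk1] := code_surj k1P.
have [||_] := @step x y xz yl; [by rewrite yk1 | move=> j lt_j5 |].
  by rewrite xk1 yk1 => xy; apply: k1_diff; rewrite // xy negbK.
rewrite -testbit_code // yk1 k1i => /esym/negbFE zi.
(* A step that raises bit i forces the opposite. *)
have [x' xz' xk] := testbit_leaf_codesP _ _ Ak.
have [] := axis_upper axis _ Mk; first by rewrite -xk code_points.
move=> khP Mkh _ ki k_diff; move: AMkh; rewrite Mkh andbT => Akh.
have [y' yl' ykh] := code_surj khP.
have [||] := @step x' y' xz' yl'; [by rewrite ykh | by rewrite xk ykh|].
by rewrite -testbit_code // xk ki zi.
Qed.

Lemma leaf_codes_split z z1 z2 : below z = below z1 ++ below z2 ->
  leaf_codes z = N.lor (leaf_codes z1) (leaf_codes z2).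
Proof.
move=> zE; apply: N.bits_inj => k.
by rewrite N.lor_spec !testbit_set_of zE map_cat mem_cat.
Qed.

Lemma leaf_codes_disjoint z z1 z2 : below z = below z1 ++ below z2 ->
  N.land (leaf_codes z1) (leaf_codes z2) = 0.
Proof.
move=> zE; apply: N.bits_inj_0 => k; rewrite N.land_spec.
apply/negP => /andP[/testbit_leaf_codesP[x xz1 <-] /testbit_leaf_codesP[y yz2 /code_inj yx]].
have := uniq_below z; rewrite zE cat_uniq => /and3P[_ /hasPn/(_ y yz2)/negP[]].
move: (xz1) (yz2); rewrite !mem_below => /andP[_ xl] /andP[_ yl].
by rewrite (yx yl xl) -mem_below.
Qed.

Lemma join_leaf_codes z z1 z2 X Y : below z = below z1 ++ below z2 ->
  leaf_codes z1 \in X -> leaf_codes z2 \in Y -> leaf_codes z \in join X Y.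
Proof.
move=> zE z1X z2Y; rewrite mem_undup; apply/mapP.
exists (leaf_codes z1, leaf_codes z2); last exact: leaf_codes_split.
rewrite mem_filter /= -(leaf_codes_split zE) leaf_codes_unate.
rewrite (leaf_codes_disjoint zE) eqxx.
by apply/allpairsP; exists (leaf_codes z1, leaf_codes z2).
Qed.

Lemma leaf_codes_tip z : below z == [:: z] -> leaf_codes z \in singletons.
Proof.
move=> /eqP zE; rewrite /leaf_codes zE.
exact: (map_f (fun k => set_of [:: k]) (code_points z)).
Qed.

(** The branch at z has 2, 4 or 8 leaves and is balanced: its two halves start at
    z + 1 and at z + 2, z + 4, z + 8 respectively. *)
Definition cherry_at z :=
  [&& below z == below (z + 1) ++ below (z + 2), below (z + 1) == [:: z + 1]%N &
      below (z + 2) == [:: z + 2]%N].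
Definition square_at z :=
  [&& below z == below (z + 1) ++ below (z + 4), cherry_at (z + 1) & cherry_at (z + 4)].
Definition cube_at z :=
  [&& below z == below (z + 1) ++ below (z + 8), square_at (z + 1) & square_at (z + 8)].

Lemma leaf_codes_cherry z : cherry_at z -> leaf_codes z \in cand2.
Proof.
move=> /and3P[/eqP zE tip1 tip2]; rewrite cand2E.
by apply: (join_leaf_codes zE); apply: leaf_codes_tip.
Qed.

Lemma leaf_codes_square z : square_at z -> leaf_codes z \in cand4.
Proof.
move=> /and3P[/eqP zE sq1 sq2]; rewrite cand4E.
by apply: (join_leaf_codes zE); apply: leaf_codes_cherry.
Qed.

Lemma leaf_codes_cube z : cube_at z -> leaf_codes z \in cand8.
Proof.
move=> /and3P[/eqP zE sq1 sq2]; rewrite cand8E.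
by apply: (join_leaf_codes zE); apply: leaf_codes_square.
Qed.

Lemma leaf_codes_tip32 : leaf_codes 32 \in [:: 1].
Proof.
have -> : leaf_codes 32 = codes [:: 32%N].
  by rewrite /leaf_codes (_ : below 32 = [:: 32%N]) //; vm_compute.
by rewrite /codes /= /code !s_leaf32.
Qed.

Lemma leaf_codes17 : leaf_codes 29 \in cand17.
Proof.
rewrite cand17E.
apply: (@join_leaf_codes _ 30 55); [by vm_compute | | exact: leaf_codes_square].
apply: (@join_leaf_codes _ 31 40); [by vm_compute | | exact: leaf_codes_cube].
apply: (@join_leaf_codes _ 32 33); [by vm_compute | | exact: leaf_codes_square].
exact: leaf_codes_tip32.
Qed.

Lemma leaf_codes17_completable : completable (leaf_codes 29).
Proof.
have below_sub z : {subset below z <= leaf_list}.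
  by move=> x; rewrite mem_below => /andP[].
have filter_sub (P : pred nat) l : {subset l <= leaf_list} ->
    {subset [seq x <- l | P x] <= leaf_list}.
  by move=> l_sub x; rewrite mem_filter => /andP[_ /l_sub].
have leaf_sub : {subset leaf_list <= leaf_list} by [].
have subNE l z : all (mem l) (below z) -> subN (leaf_codes z) (codes l).
  move=> /allP z_sub; apply/subNP => k; rewrite !testbit_set_of => /mapP[x /z_sub xl ->].
  exact: map_f.
pose rest := [seq x <- leaf_list | x \notin below 29].
have rest_sub : {subset rest <= leaf_list} by exact: filter_sub.
have restE : N.ldiff (codes leaf_list) (leaf_codes 29) = codes rest.
  exact: (codes_ldiff leaf_sub (below_sub 29)).
have BE : N.ldiff (codes rest) (leaf_codes 26) = leaf_codes 1.
  rewrite (codes_ldiff rest_sub (below_sub 26)).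
  by rewrite (_ : [seq x <- rest | x \notin below 26] = below 1) //; vm_compute.
have WO : N.ldiff (leaf_codes 1) (leaf_codes 11) = leaf_codes 2.
  rewrite (codes_ldiff (below_sub 1) (below_sub 11)).
  by rewrite (_ : [seq x <- below 1 | x \notin below 11] = below 2) //; vm_compute.
rewrite /completable codes_points restE.
apply/hasP; exists (leaf_codes 26); first exact: leaf_codes_cherry.
rewrite BE leaf_codes_unate subNE; last by vm_compute.
apply/hasP; exists (leaf_codes 11); first exact: leaf_codes_cube.
rewrite WO leaf_codes_unate subNE; last by vm_compute.
apply/hasP; exists (leaf_codes 4); first exact: leaf_codes_square.
by apply: subNE; vm_compute.
Qed.

End LowerBound.

Lemma no_five_orientations (s : nat -> nat -> bool) :
  ~ (forall u v : 'I_62, u != v -> exists2 i, (i < 5)%N & directed par 61 (s i) u v).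
Proof.
move=> dir; pose s' i z := s i z (+) s i 32.
have dir' (u v : 'I_62) : u != v -> exists2 i, (i < 5)%N & directed par 61 (s' i) u v.
  move=> /dir[i lt_i5 [b bP]]; exists i => //.
  by exists (b (+) s i 32) => z z_in zs; rewrite -(bP z z_in zs) /s' addbAC.
have s'32 i : (i < 5)%N -> s' i 32 = false by rewrite /s' addbb.
have := not_completable; rewrite -all_predC => /allP/(_ _ (leaf_codes17 dir' s'32)).
by rewrite /= (leaf_codes17_completable dir').
Qed.

End Tree.

(** * The embedding dimension *)

Local Open Scope ring_scope.

Theorem theorem1p1 :
  exists (V : finType) (e : rel V),
    [/\ is_tree e,
        #|leaves e| = 32%N,
        (forall v : V, degree e v = 1%N \/ degree e v = 3%N) &
        forall (R : realType) (w : edge e -> R),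
          (forall a : edge e, 0 < w a) -> least_linf_dim w 6].
Proof.
exists 'I_62, (parent_rel par (n := 61)); split.
- exact: (parent_tree par_lt 61).
- exact: card_leaves_par.
- by move=> v; rewrite degree_par degrees_par //; case: ifP; [left | right].
move=> R w w_gt0; split.
  have n_gt0 : (0 < 61)%N by [].
  apply: (embeds_of_orientations par_lt w_gt0 n_gt0
    (s := fun i : 'I_6 => level_orientation i)).
  exact: level_orientation_directed.
move=> k /(orientations_of_embeds par_lt w_gt0)[s s_dir].
rewrite leqNgt; apply/negP => lt_k6.
(* Any orientations complete the k given ones to five. *)
apply: (@no_five_orientations (fun i z => oapp (s^~ z) false (insub i))) => u v uv.
have [i dir_i] := s_dir u v uv; exists (val i); first exact: leq_trans (ltn_ord i) _.
by rewrite valK.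
Qed.
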